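(* Maehara interpolation in $\mathbf{LK}^{\mathrm{at}}$ is complete: for every valid implication $A\to B$ and every interpolant $C$ of $A\to B$ there is an $\mathbf{LK}^{\mathrm{at}}$ proof $\pi$ of the split sequent $A;\Rightarrow;B$ such that $\mathcal{M}(\pi)$ is logically equivalent to $C$.
   Context: Propositional formulas are built from atoms and $\bot$ using $\wedge,\vee,\neg$; $A\to B$ abbreviates $\neg A\vee B$; $\top$ abbreviates $\bot\to\bot$. $V(A)$ is the set of atoms of $A$ (extended to multisets by union). An interpolant of a valid $A\to B$ is a formula $C$ with $V(C)\subseteq V(A)\cap V(B)$ such that $A\to C$ and $C\to B$ are valid. $\mathbf{LK}$ is the sequent calculus (sequents $\Gamma\Rightarrow\Delta$ of finite multisets) with axioms $p\Rightarrow p$ ($p$ an atom) and $\bot\Rightarrow$, and rules: weakening and contraction on both sides; $(L\wedge_1)$: $A,\Gamma\Rightarrow\Delta$ / $A\wedge B,\Gamma\Rightarrow\Delta$; $(L\wedge_2)$: $B,\Gamma\Rightarrow\Delta$ / $A\wedge B,\Gamma\Rightarrow\Delta$; $(R\wedge)$: $\Gamma\Rightarrow\Delta,A$ and $\Gamma\Rightarrow\Delta,B$ / $\Gamma\Rightarrow\Delta,A\wedge B$; $(R\vee_1)$, $(R\vee_2)$: $\Gamma\Rightarrow\Delta,A$ (resp. $B$) / $\Gamma\Rightarrow\Delta,A\vee B$; $(L\vee)$: $A,\Gamma\Rightarrow\Delta$ and $B,\Gamma\Rightarrow\Delta$ / $A\vee B,\Gamma\Rightarrow\Delta$; $(L\neg)$: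 $\Gamma\Rightarrow\Delta,A$ / $\neg A,\Gamma\Rightarrow\Delta$; $(R\neg)$: $A,\Gamma\Rightarrow\Delta$ / $\Gamma\Rightarrow\Delta,\neg A$; cut: $\Gamma\Rightarrow\Delta,A$ and $A,\Gamma\Rightarrow\Delta$ / $\Gamma\Rightarrow\Delta$. $\mathbf{LK}^{\mathrm{at}}$ allows only cuts whose cut formula is an atom, $\bot$ or $\top$. A split sequent $\Gamma_1;\Gamma_2\Rightarrow\Delta_1;\Delta_2$ is the sequent $\Gamma_1,\Gamma_2\Rightarrow\Delta_1,\Delta_2$ with formulas divided into a left side ($\Gamma_1,\Delta_1$) and a right side ($\Gamma_2,\Delta_2$). In a proof of a split sequent every sequent is split, context formulas keep their side, auxiliary formulas lie on the side of the main formula, and for a cut with conclusion $\Gamma_1;\Gamma_2\Rightarrow\Delta_1;\Delta_2$ and cut formula $A$ both occurrences of $A$ lie on the left side (allowed only if $V(A)\subseteq V(\Gamma_1\cup\Delta_1)$) or both on the right side (allowed only if $V(A)\subseteq V(\Gamma_2\cup\Delta_2)$). The Maehara interpolant $\mathcal{M}(\pi)$: axioms $p;\Rightarrow p;$ give $\bot$, $;p\Rightarrow;p$ give $\top$, $p;\Rightarrow;p$ give $p$, $;p\Rightarrow p;$ give $\neg p$, $\bot;\Rightarrow;$ gives $\bot$, $;\bot\Rightarrow;$ gives $\top$; unary rules keep the premise's interpolant; a binary rule ($(R\wedge)$, $(L\vee)$, cut) with premise proofs $\pi_1,\pi_2$ gives $\mathcal{M}(\pi_1)\vee\mathcal{M}(\pi_2)$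 if its main/cut formula is on the left side and $\mathcal{M}(\pi_1)\wedge\mathcal{M}(\pi_2)$ if on the right side. *)

(* Defs.v *)
From HB Require Import structures.
From mathcomp Require Import all_boot finmap multiset.

Set Implicit Arguments.
Unset Strict Implicit.
Unset Printing Implicit Defensive.

Local Open Scope mset_scope.
Local Open Scope fset_scope.

Inductive form (X : Type) : Type :=
  | Atom of X
  | Bot
  | And of form X & form X
  | Or of form X & form X
  | Neg of form X.

Arguments Bot {X}.

Definition Imp (X : Type) (A B : form X) : form X := Or (Neg A) B.
Definition Top (X : Type) : form X := Imp Bot Bot.
Arguments Top {X}.

(* The choiceType structure on formulas, needed for {mset form X}, is
   transported from generic trees. *)
Section FormChoice.
Variable X : choiceType.

Fixpoint form_enc (A : form X) : GenTree.tree X :=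
  match A with
  | Atom p => GenTree.Leaf p
  | Bot => GenTree.Node 0 [::]
  | And A B => GenTree.Node 1 [:: form_enc A; form_enc B]
  | Or A B => GenTree.Node 2 [:: form_enc A; form_enc B]
  | Neg A => GenTree.Node 3 [:: form_enc A]
  end.

Fixpoint form_dec (t : GenTree.tree X) : option (form X) :=
  match t with
  | GenTree.Leaf p => Some (Atom p)
  | GenTree.Node 0 [::] => Some Bot
  | GenTree.Node 1 [:: t; u] =>
      if (form_dec t, form_dec u) is (Some A, Some B) then Some (And A B)
      else None
  | GenTree.Node 2 [:: t; u] =>
      if (form_dec t, form_dec u) is (Some A, Some B) then Some (Or A B)
      else None
  | GenTree.Node 3 [:: t] =>
      if form_dec t is Some A then Some (Neg A) else None
  | _ => None
  end.

Lemma form_encK : pcancel form_enc form_dec.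
Proof. by elim=> //= [A -> B ->|A -> B ->|A ->]. Qed.

HB.instance Definition _ := Choice.copy (form X) (pcan_type form_encK).

End FormChoice.

Fixpoint eval (X : Type) (v : X -> bool) (A : form X) : bool :=
  match A with
  | Atom p => v p
  | Bot => false
  | And A B => eval v A && eval v B
  | Or A B => eval v A || eval v B
  | Neg A => ~~ eval v A
  end.

Definition valid (X : Type) (A : form X) : Prop :=
  forall v : X -> bool, eval v A.

Definition equivalent (X : Type) (A B : form X) : Prop :=
  forall v : X -> bool, eval v A = eval v B.

Fixpoint atoms (X : choiceType) (A : form X) : {fset X} :=
  match A with
  | Atom p => [fset p]
  | Bot => fset0
  | And A B => atoms A `|` atoms B
  | Or A B => atoms A `|` atoms B
  | Neg A => atoms A
  end.

Definition matoms (X : choiceType) (G : {mset form X}) : {fset X} :=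
  \bigcup_(A <- (G : seq (form X))) atoms A.

Definition interpolant (X : choiceType) (A B C : form X) : Prop :=
  [/\ atoms C `<=` atoms A `&` atoms B,
      valid (Imp A C) & valid (Imp C B)].

Inductive side := Left | Right.

(* [SSeq G1 G2 D1 D2] is the split sequent G1; G2 => D1; D2. *)
Record ssequent (X : choiceType) := SSeq {
  anteL : {mset form X};
  anteR : {mset form X};
  succL : {mset form X};
  succR : {mset form X} }.

Definition empty_seq (X : choiceType) : ssequent X :=
  SSeq mset0 mset0 mset0 mset0.
Arguments empty_seq {X}.

Definition addA (X : choiceType) (s : side) (A : form X) (S : ssequent X) :=
  let: SSeq G1 G2 D1 D2 := S in
  match s with
  | Left => SSeq (A +` G1) G2 D1 D2
  | Right => SSeq G1 (A +` G2) D1 D2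
  end.

Definition addS (X : choiceType) (s : side) (A : form X) (S : ssequent X) :=
  let: SSeq G1 G2 D1 D2 := S in
  match s with
  | Left => SSeq G1 G2 (A +` D1) D2
  | Right => SSeq G1 G2 D1 (A +` D2)
  end.

Definition side_atoms (X : choiceType) (s : side) (S : ssequent X) :
    {fset X} :=
  match s with
  | Left => matoms (anteL S `+` succL S)
  | Right => matoms (anteR S `+` succR S)
  end.

(* LK proofs of split sequents, with unrestricted cut formulas. [S] is the
   split context of a rule and [s] the side of its main (or cut) formula; in
   [Ax s t p] the antecedent occurrence of p is on side [s] and the succedent
   occurrence on side [t]. *)
Inductive proof (X : choiceType) : ssequent X -> Type :=
  | Ax (s t : side) (p : X) :
      proof (addA s (Atom p) (addS t (Atom p) empty_seq))
  | AxBot (s : side) : proof (addA s Bot empty_seq)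
  | WeakL (s : side) (A : form X) (S : ssequent X) :
      proof S -> proof (addA s A S)
  | WeakR (s : side) (A : form X) (S : ssequent X) :
      proof S -> proof (addS s A S)
  | ContrL (s : side) (A : form X) (S : ssequent X) :
      proof (addA s A (addA s A S)) -> proof (addA s A S)
  | ContrR (s : side) (A : form X) (S : ssequent X) :
      proof (addS s A (addS s A S)) -> proof (addS s A S)
  | LAnd1 (s : side) (A B : form X) (S : ssequent X) :
      proof (addA s A S) -> proof (addA s (And A B) S)
  | LAnd2 (s : side) (A B : form X) (S : ssequent X) :
      proof (addA s B S) -> proof (addA s (And A B) S)
  | RAnd (s : side) (A B : form X) (S : ssequent X) :
      proof (addS s A S) -> proof (addS s B S) -> proof (addS s (And A B) S)
  | ROr1 (s : side) (A B : form X) (S : ssequent X) :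
      proof (addS s A S) -> proof (addS s (Or A B) S)
  | ROr2 (s : side) (A B : form X) (S : ssequent X) :
      proof (addS s B S) -> proof (addS s (Or A B) S)
  | LOr (s : side) (A B : form X) (S : ssequent X) :
      proof (addA s A S) -> proof (addA s B S) -> proof (addA s (Or A B) S)
  | LNeg (s : side) (A : form X) (S : ssequent X) :
      proof (addS s A S) -> proof (addA s (Neg A) S)
  | RNeg (s : side) (A : form X) (S : ssequent X) :
      proof (addA s A S) -> proof (addS s (Neg A) S)
  | Cut (s : side) (A : form X) (S : ssequent X) :
      atoms A `<=` side_atoms s S ->
      proof (addS s A S) -> proof (addA s A S) -> proof S.

Definition at_cut_form (X : choiceType) (A : form X) : Prop :=
  (exists p : X, A = Atom p) \/ A = Bot \/ A = Top.

Fixpoint is_LKat (X : choiceType) (S : ssequent X) (pi : proof S) : Prop :=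
  match pi with
  | Ax _ _ _ | AxBot _ => True
  | WeakL _ _ _ pi1 | WeakR _ _ _ pi1
  | ContrL _ _ _ pi1 | ContrR _ _ _ pi1
  | LAnd1 _ _ _ _ pi1 | LAnd2 _ _ _ _ pi1
  | ROr1 _ _ _ _ pi1 | ROr2 _ _ _ _ pi1
  | LNeg _ _ _ pi1 | RNeg _ _ _ pi1 => is_LKat pi1
  | RAnd _ _ _ _ pi1 pi2 | LOr _ _ _ _ pi1 pi2 => is_LKat pi1 /\ is_LKat pi2
  | Cut _ A _ _ pi1 pi2 => at_cut_form A /\ is_LKat pi1 /\ is_LKat pi2
  end.

Definition side_op (X : Type) (s : side) : form X -> form X -> form X :=
  match s with Left => @Or X | Right => @And X end.

Fixpoint maehara (X : choiceType) (S : ssequent X) (pi : proof S) : form X :=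
  match pi with
  | Ax Left Left _ => Bot
  | Ax Right Right _ => Top
  | Ax Left Right p => Atom p
  | Ax Right Left p => Neg (Atom p)
  | AxBot Left => Bot
  | AxBot Right => Top
  | WeakL _ _ _ pi1 | WeakR _ _ _ pi1
  | ContrL _ _ _ pi1 | ContrR _ _ _ pi1
  | LAnd1 _ _ _ _ pi1 | LAnd2 _ _ _ _ pi1
  | ROr1 _ _ _ _ pi1 | ROr2 _ _ _ _ pi1
  | LNeg _ _ _ pi1 | RNeg _ _ _ pi1 => maehara pi1
  | RAnd s _ _ _ pi1 pi2 | LOr s _ _ _ pi1 pi2
  | Cut s _ _ _ pi1 pi2 => side_op s (maehara pi1) (maehara pi2)
  end.

(* Main.v *)
Require Import Defs.
From mathcomp Require Import all_boot finmap multiset.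

Set Implicit Arguments.
Unset Strict Implicit.
Unset Printing Implicit Defensive.

(** Cutting, on the left side, on every atom common to [A] and [B] reduces
    [A; => ;B] to the sequents with one extra literal per common atom, and
    disjoins their interpolants. If the literals falsify [C], they refute [A],
    and a proof using only the left side has an interpolant equivalent to
    [Bot]. If they satisfy [C], they entail [B]; cutting on the same atoms on
    the right side copies the literals there, each copy conjoining the
    corresponding literal to the interpolant, after which a proof using only
    the right side finishes. The interpolant of such a branch is the
    conjunction of its literals, and the disjunction of these conjunctions is
    the full disjunctive normal form of [C]. *)

Section MaeharaCompleteness.
Variable X : choiceType.
Implicit Types (S : ssequent X) (s t : side) (A B F : form X).
Implicit Types (l : seq (X * bool)) (v w : X -> bool).
Implicit Types (f g : (X -> bool) -> bool).

(** The interpolant is recorded only as a truth function, so equivalent interpolants are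
    interchangeable. *)
Definition derivable S f : Prop :=
  exists pi : proof S, is_LKat pi /\ forall w, eval w (maehara pi) = f w.

Lemma derivable_ext S f g : f =1 g -> derivable S f -> derivable S g.
Proof. by move=> fg [pi [at_pi piE]]; exists pi; split=> // w; rewrite piE. Qed.

(** The sign [b] is the truth value assumed for [A]: true in the antecedent, false in the succedent.
    Pairs [(p, b)] thus act as literals. *)
Definition add (b : bool) s A S := if b then addA s A S else addS s A S.

Definition lits s l S :=
  foldr (fun x : X * bool => add x.2 s (Atom x.1)) S l.

Definition agree l w := all (fun x : X * bool => w x.1 == x.2) l.

Definition val_of l : X -> bool := fun p => (p, true) \in l.

(** The truth value of the interpolant of any proof that stays on side [s]: its axioms give this
    constant and [side_bop s] preserves it. *)
Definition side_cst s := if s is Left then false else true.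

Definition side_bop s := if s is Left then orb else andb.

Lemma side_bopC s : commutative (side_bop s).
Proof. by case: s; [apply: orbC|apply: andbC]. Qed.

Lemma side_bop_cst s : side_bop s (side_cst s) (side_cst s) = side_cst s.
Proof. by case: s. Qed.

Lemma eval_side_op s A B w :
  eval w (side_op s A B) = side_bop s (eval w A) (eval w B).
Proof. by case: s. Qed.

Lemma addC b c s t A B S :
  add b s A (add c t B S) = add c t B (add b s A S).
Proof.
by case: S b c s t => G1 G2 D1 D2 [] [] [] [] //=; rewrite /add /= msetDCA.
Qed.

Lemma lits_add s l b t A S : lits s l (add b t A S) = add b t A (lits s l S).
Proof. by elim: l => //= x l ->; rewrite addC. Qed.

Lemma litsC s t l k S : lits s l (lits t k S) = lits t k (lits s l S).
Proof. by elim: k => //= x k <-; rewrite lits_add. Qed.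

Lemma derivable_weak b s A S f : derivable S f -> derivable (add b s A S) f.
Proof.
by move=> [pi H]; case: b; [exists (WeakL s A pi)|exists (WeakR s A pi)].
Qed.

Lemma derivable_lits s l S f : derivable S f -> derivable (lits s l S) f.
Proof. by move=> H; elim: l => //= x l; apply: derivable_weak. Qed.

Lemma derivable_cut s p S b f g :
  p \in side_atoms s S ->
  derivable (add b s (Atom p) S) f -> derivable (add (~~ b) s (Atom p) S) g ->
  derivable S (fun w => side_bop s (f w) (g w)).
Proof.
move=> pS H1 H2.
have pS' : (atoms (Atom p) `<=` side_atoms s S)%fset by rewrite fsub1set.
have atp : at_cut_form (Atom p) by left; exists p.
case: b H1 H2 => [[pi1 [a1 E1]] [pi2 [a2 E2]]|[pi1 [a1 E1]] [pi2 [a2 E2]]].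
  exists (Cut pS' pi2 pi1); split=> //= w.
  by rewrite eval_side_op E1 E2 side_bopC.
by exists (Cut pS' pi1 pi2); split=> //= w; rewrite eval_side_op E1 E2.
Qed.

Lemma in_side_atoms_add q b s t A S :
  (q \in side_atoms s (add b t A S)) =
  (q \in side_atoms s S) ||
    (if s is Left then if t is Left then q \in atoms A else false
     else if t is Left then false else q \in atoms A).
Proof.
have memD (G H : {mset form X}%mset) :
    (q \in matoms (G `+` H)%mset) = (q \in matoms G) || (q \in matoms H).
  apply/bigfcupP/orP => [[F]|[]/bigfcupP[F]]; rewrite ?andbT.
  - by rewrite in_msetD => /orP[] FG qF; [left|right];
      apply/bigfcupP; exists F; rewrite ?FG.
  - by move=> FG qF; exists F; rewrite // in_msetD FG.
  - by move=> FG qF; exists F; rewrite // in_msetD FG orbT.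
have mem1 : (q \in matoms [mset A]%mset) = (q \in atoms A).
  apply/bigfcupP/idP => [[F]|qA]; rewrite ?andbT.
    by rewrite in_mset1 => /eqP->.
  by exists A; rewrite // in_mset1 eqxx.
case: S b s t => G1 G2 D1 D2 [] [] [] /=; rewrite /add /= !memD ?mem1 ?orbF //;
  by do ![case: (_ \in _)].
Qed.

Lemma side_atoms_lits q s t l S :
  q \in side_atoms s S -> q \in side_atoms s (lits t l S).
Proof. by move=> qS; elim: l => // x l IH; rewrite in_side_atoms_add IH. Qed.

(** Induction on [ps]: the cuts on the tail lie nearest the root, and each branch they open is split
    once more on [p]. The first hypothesis lets every cut merge two branch interpolants into that of
    their parent. *)
Lemma derivable_cuts s (h : seq (X * bool) -> (X -> bool) -> bool)
    (ps : seq X) S :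
  (forall l p w,
     side_bop s (h ((p, true) :: l) w) (h ((p, false) :: l) w) = h l w) ->
  {subset ps <= side_atoms s S} ->
  (forall l, unzip1 l = ps -> derivable (lits s l S) (h l)) ->
  derivable S (h [::]).
Proof.
move=> hE; elim: ps => [|p ps IH] sub H; first exact: (H [::]).
apply: IH => [q qps|l lps]; first by apply: sub; rewrite inE qps orbT.
apply: (derivable_ext (hE l p)); apply: (@derivable_cut _ p _ true).
- exact/side_atoms_lits/sub/mem_head.
- by apply: (H ((p, true) :: l)); rewrite /= lps.
- by apply: (H ((p, false) :: l)); rewrite /= lps.
Qed.

Lemma derivable_axiom s b p :
  derivable (add b s (Atom p) (add (~~ b) s (Atom p) empty_seq))
    (fun=> side_cst s).
Proof.
by case: b; [|rewrite addC]; exists (Ax s s p); split=> //; case: s.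
Qed.

(** These are the leaves through which atoms enter the interpolant. *)
Lemma derivable_axiom_split b p :
  derivable (add b Left (Atom p) (add (~~ b) Right (Atom p) empty_seq))
    (fun w => w p == b).
Proof.
case: b; first by exists (Ax Left Right p); split=> //= w; case: (w p).
by rewrite addC; exists (Ax Right Left p); split=> //= w; case: (w p).
Qed.

Lemma lits_rem s l x S : x \in l ->
  lits s l S = add x.2 s (Atom x.1) (lits s (rem x l) S).
Proof.
elim: l => //= y l IH; rewrite inE eq_sym.
by case: (altP (y =P x)) => [->//|_ /= /IH ->]; rewrite addC.
Qed.

(* Kalmar's lemma. *)
Lemma derivable_eval s l v F :
  (forall p, p \in atoms F -> (p, v p) \in l) ->
  derivable (add (~~ eval v F) s F (lits s l empty_seq)) (fun=> side_cst s).
Proof.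
elim: F => [p||A IHA B IHB|A IHA B IHB|A IHA] /= sub.
- rewrite (lits_rem _ _ (sub p _)) ?inE //= -!lits_add.
  by apply: derivable_lits; rewrite addC; apply: derivable_axiom.
- rewrite -[addA _ _ _]/(add true _ _ _) -lits_add.
  by apply: derivable_lits; exists (AxBot X s); split=> //; case: s.
- have {}IHA := IHA (fun p pA => sub p (fsubsetP (fsubsetUl _ _) p pA)).
  have {}IHB := IHB (fun p pB => sub p (fsubsetP (fsubsetUr _ _) p pB)).
  case: (eval v A) IHA => /= [[pi1 [a1 E1]]|[pi [a E]]];
    last by exists (LAnd1 B pi).
  case: (eval v B) IHB => /= [[pi2 [a2 E2]]|[pi [a E]]];
    last by exists (LAnd2 A pi).
  exists (RAnd pi1 pi2); split=> //= w.
  by rewrite eval_side_op E1 E2 side_bop_cst.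
- have {}IHA := IHA (fun p pA => sub p (fsubsetP (fsubsetUl _ _) p pA)).
  have {}IHB := IHB (fun p pB => sub p (fsubsetP (fsubsetUr _ _) p pB)).
  case: (eval v A) IHA => /= [[pi [a E]]|[pi1 [a1 E1]]];
    first by exists (ROr1 B pi).
  case: (eval v B) IHB => /= [[pi [a E]]|[pi2 [a2 E2]]];
    first by exists (ROr2 A pi).
  exists (LOr pi1 pi2); split=> //= w.
  by rewrite eval_side_op E1 E2 side_bop_cst.
- case: (eval v A) (IHA sub) => -[pi [a E]]; first by exists (LNeg pi).
  by exists (RNeg pi).
Qed.

(* No consistency of [l] is needed: if [l] has both literals of an atom, [val_of]
   just picks the positive one. *)
Lemma mem_val_of l p : p \in unzip1 l -> (p, val_of l p) \in l.
Proof.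
rewrite /val_of => /mapP[[q b] ql /= ->].
by case: (boolP ((q, true) \in l)) => //; case: b ql => [->|].
Qed.

(** Cuts on all atoms of [F] give each branch a valuation [val_of k]. If it agrees with [l], it
    gives [F] the value [~~ b] and Kalmar's lemma applies; otherwise some atom has opposite signs in
    [l] and [k], and an axiom closes the branch. *)
Lemma derivable_one_sided b s F l :
  {subset unzip1 l <= atoms F} ->
  (forall w, agree l w -> eval w F = ~~ b) ->
  derivable (add b s F (lits s l empty_seq)) (fun=> side_cst s).
Proof.
move=> sub lF.
apply: (@derivable_cuts s (fun _ _ => side_cst s) (atoms F)) => [*||k kF].
- exact: side_bop_cst.
- by move=> p pF; rewrite in_side_atoms_add; case: (s); rewrite pF orbT.
have kv p : p \in atoms F -> (p, val_of k p) \in k.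
  by rewrite -[_ \in _]/(p \in (atoms F : seq X)) -kF; apply: mem_val_of.
rewrite lits_add litsC.
have [/lF evF|] := boolP (agree l (val_of k)).
  rewrite -lits_add; apply: derivable_lits.
  by have := derivable_eval s kv; rewrite evF negbK.
case/allPn=> -[p c] pl /= kpc; apply: derivable_weak.
rewrite (lits_rem _ _ pl) (lits_rem _ _ (kv p _)) /=; last first.
  by apply: sub; apply/mapP; exists (p, c).
rewrite lits_add -!lits_add; do 2!apply: derivable_lits.
have -> : val_of k p = ~~ c by case: (c) (val_of k p) kpc => -[].
exact: derivable_axiom.
Qed.

(** One right cut per literal: one premise gains the literal on the right, the other is closed by
    the second hypothesis with the literal itself as interpolant, and right cuts conjoin. *)
Lemma derivable_copy_right S f l :
  {subset unzip1 l <= side_atoms Right S} ->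
  (forall x, x \in l ->
    derivable (add (~~ x.2) Right (Atom x.1) S) (fun w => w x.1 == x.2)) ->
  derivable (lits Right l S) f -> derivable S (fun w => f w && agree l w).
Proof.
elim: l f => [|x l IH] f sub ax /= H.
  by apply: derivable_ext H => w; rewrite andbT.
have: derivable S (fun w => (f w && (w x.1 == x.2)) && agree l w).
  apply: IH => [p pl|y yl|].
  - by apply: sub; rewrite /= inE pl orbT.
  - by apply: ax; rewrite inE yl orbT.
  apply: (derivable_cut (s := Right) _ H).
    exact/side_atoms_lits/sub/mem_head.
  by rewrite -lits_add; apply/derivable_lits/ax/mem_head.
by apply: derivable_ext => w; rewrite andbA.
Qed.

Lemma eval_eq_in v w F :
  (forall p, p \in atoms F -> v p = w p) -> eval v F = eval w F.
Proof.
elim: F => [p||A IHA B IHB|A IHA B IHB|A IHA] //= vw.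
- by apply: vw; rewrite inE.
- by rewrite IHA ?IHB // => p pF; apply: vw; rewrite inE pF ?orbT.
- by rewrite IHA ?IHB // => p pF; apply: vw; rewrite inE pF ?orbT.
- by rewrite IHA.
Qed.

End MaeharaCompleteness.

Theorem theorem6p1 (X : choiceType) (A B C : form X) :
  valid (Imp A B) ->
  interpolant A B C ->
  exists pi : proof (SSeq [mset A]%mset mset0 mset0 [mset B]%mset),
    is_LKat pi /\ equivalent (maehara pi) C.
Proof.
move=> _ [subC AC CB].
have -> : SSeq [mset A]%mset mset0 mset0 [mset B]%mset =
    add true Left A (add false Right B empty_seq).
  by rewrite /add /= !msetD0.
set S0 := add _ _ _ _.
have derC : derivable S0 (fun w => eval w C && agree [::] w).
  (* The branch [l] contributes the part of [C] that lies over its literals; two sibling branches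
     differ only in the sign of [p], so their disjunction drops that literal. *)
  apply: (@derivable_cuts _ Left (fun l w => eval w C && agree l w)
           (atoms A `&` atoms B)%fset) => [l p w|p|l lAB].
  - by rewrite /=; case: (w p); case: (eval w C); case: (agree l w).
  - by rewrite !in_side_atoms_add inE => /andP[-> _]; rewrite orbT.
  have subA : {subset unzip1 l <= atoms A}.
    by rewrite lAB => p; rewrite inE => /andP[].
  have subB : {subset unzip1 l <= atoms B}.
    by rewrite lAB => p; rewrite inE => /andP[].
  (* The literals decide every atom of [C], so [C] is constant on the valuations agreeing with
     [l]. *)
  have evC w : agree l w -> eval w C = eval (val_of l) C.
    move=> /allP lw; apply: eval_eq_in => p /(fsubsetP subC) pAB.
    by apply/eqP/(lw (p, _))/mem_val_of; rewrite lAB.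
  case Cl: (eval (val_of l) C).
    (* Here [true] comes from the proof of [B] on the right side, and [agree l w] from the copied
       literals. *)
    have: derivable (lits Left l S0) (fun w => true && agree l w).
      apply: derivable_copy_right => [p pl|[p b] pl|].
      - by apply: side_atoms_lits; rewrite !in_side_atoms_add (subB p pl) orbT.
      (* The left literal meets its opposite on the right; everything else, including [A] and [B],
         is weakened away. *)
      - rewrite (lits_rem _ _ pl) addC -!lits_add; apply: derivable_lits.
        rewrite (addC _ true) (addC _ true); apply: derivable_weak.
        rewrite (addC _ false) (addC _ false); apply: derivable_weak.
        exact: derivable_axiom_split.
      rewrite litsC; apply: derivable_lits; rewrite !lits_add.
      apply: derivable_weak; apply: (derivable_one_sided Right) => //.
      by move=> w lw; have := CB w; rewrite /= evC // Cl.
    apply: derivable_ext => w /=.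
    by case: (boolP (agree l w)) => [/evC->|_]; rewrite ?Cl ?andbF.
  (* The literals falsify [C], hence refute [A]; [B] is weakened away. *)
  have: derivable (lits Left l S0) (fun=> false).
    rewrite !lits_add addC; apply: derivable_weak.
    apply: (derivable_one_sided Left) => // w lw.
    by have := AC w; rewrite /= evC // Cl orbF => /negbTE.
  apply: derivable_ext => w.
  by case: (boolP (agree l w)) => [/evC->|_]; rewrite ?Cl ?andbF.
by have [pi [at_pi piE]] := derC; exists pi; split=> // w; rewrite piE andbT.
Qed.
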